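(* For every integer $n\geq1$, $$\deg_z P(T(3,n);y,z)=2n-2,$$ and the highest-degree term of $P(T(3,n);y,z)$ with respect to $z$ is $y^{-2n+2}z^{2n-2}$ (that is, the coefficient of $z^{2n-2}$ is exactly $y^{-2n+2}$, and no higher power of $z$ occurs).
   Context: A crossing of an oriented link diagram in the oriented plane is positive if the ordered pair (tangent vector of the overpassing arc, tangent vector of the underpassing arc) agrees with the orientation of the plane, and negative otherwise. $B_3$ denotes the braid group on $3$ strands with Artin generators $\sigma_1,\sigma_2$, where $\sigma_i$ is the elementary braid in which the $i$th and $(i+1)$st strands form a positive crossing (all strands oriented in the same direction along the braid). $\overline{x}$ denotes the closure of a braid $x$, an oriented link, and $T(3,n)=\overline{(\sigma_1\sigma_2)^n}$ for $n\in\mathbb{Z}$. The HOMFLY polynomial $P(L;y,z)\in\mathbb{Z}[y^{\pm1},z^{\pm1}]$ of an oriented link $L$ is the unique oriented link invariant, computed from any diagram, with $P(\text{unknot};y,z)=1$ and $yP(D_+;y,z)+y^{-1}P(D_-;y,z)=zP(D_0;y,z)$ for every skein triple $(D_+,D_-,D_0)$, i.e. three oriented diagrams identical except near one crossing, where the crossing is respectively positive, negative, and smoothed (orientation-consistently). For a nonzero Laurent polynomial, $\deg_z$ denotes the largest exponent of $z$ occurring with nonzero coefficient in $\mathbb{Z}[y^{\pm1}]$. *)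

(* Defs.v *)
From HB Require Import structures.
From mathcomp Require Import all_boot all_order all_algebra finmap.
From mathcomp Require Import monalg.

Set Implicit Arguments.
Unset Strict Implicit.
Unset Printing Implicit Defensive.

Import Order.TTheory GRing.Theory Num.Theory.
Local Open Scope ring_scope.

(** * Laurent polynomials

    Finitely supported functions [int -> R] with the convolution product.  The
    ring structure that [monalg] puts on [{malg R[K]}] does not apply: it
    requires the monoid [K] of exponents to have no invertible element. *)

Definition laurent (R : comNzRingType) : Type := {malg R[int]}.

HB.instance Definition _ (R : comNzRingType) := GRing.Zmodule.on (laurent R).

Section LaurentRing.
Variable R : comNzRingType.
Implicit Types (f g h : laurent R) (a b : R) (k : int).

Definition lcoef f k : R := mcoeff k f.
Definition lmonom a k : laurent R := << a *g k >>.
Definition lone : laurent R := lmonom 1 0.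
Definition lmul f g : laurent R :=
  \sum_(k1 <- msupp f) \sum_(k2 <- msupp g)
     lmonom (lcoef f k1 * lcoef g k2) (k1 + k2).

Lemma lmulw (d1 d2 : {fset int}) f g :
  (msupp f `<=` d1)%fset -> (msupp g `<=` d2)%fset ->
  lmul f g = \sum_(k1 <- d1) \sum_(k2 <- d2)
               lmonom (lcoef f k1 * lcoef g k2) (k1 + k2).
Proof.
move=> le_d1 le_d2; rewrite /lmul (big_fset_incl _ le_d1) /=.
  apply/eq_bigr=> k1 _; apply/big_fset_incl => // k _ /mcoeff_outdom.
  by rewrite /lcoef => ->; rewrite mulr0 /lmonom monalgU0.
move=> k _ /mcoeff_outdom; rewrite /lcoef => ->.
by rewrite big1 => // k' _; rewrite mul0r /lmonom monalgU0.
Qed.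

Lemma lmulC : commutative lmul.
Proof.
move=> f g; rewrite /lmul exchange_big /=.
by apply/eq_bigr=> k _; apply/eq_bigr=> l _; rewrite mulrC addrC.
Qed.

Lemma lmul0l : left_zero 0 lmul.
Proof. by move=> f; rewrite /lmul msupp0 big_seq_fset0. Qed.

Lemma lmulDl : left_distributive lmul +%R.
Proof.
move=> f g h.
rewrite (lmulw (msuppD_le f g) (fsubset_refl _)).
rewrite (lmulw (fsubsetUl (msupp f) (msupp g)) (fsubset_refl (msupp h))).
rewrite (lmulw (fsubsetUr (msupp f) (msupp g)) (fsubset_refl (msupp h))).
rewrite -big_split /=; apply/eq_bigr=> k1 _.
rewrite -big_split /=; apply/eq_bigr=> k2 _.
by rewrite /lcoef mcoeffD mulrDl /lmonom monalgUD.
Qed.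

Lemma lmulDr : right_distributive lmul +%R.
Proof. by move=> f g h; rewrite lmulC lmulDl !(lmulC _ f). Qed.

Lemma lmulUU a b k1 k2 :
  lmul (lmonom a k1) (lmonom b k2) = lmonom (a * b) (k1 + k2).
Proof.
by rewrite (lmulw msuppU_le msuppU_le) !big_seq_fset1 /lcoef !mcoeffUU.
Qed.

Lemma laurentE f : f = \sum_(k <- msupp f) lmonom (lcoef f k) k.
Proof. exact: monalgE. Qed.

Lemma lmul_suml (I : Type) (s : seq I) (F : I -> laurent R) g :
  lmul (\sum_(i <- s) F i) g = \sum_(i <- s) lmul (F i) g.
Proof. exact: (big_morph (lmul^~ g) (fun _ _ => lmulDl _ _ _) (lmul0l _)). Qed.

Lemma lmul_sumr (I : Type) (s : seq I) (F : I -> laurent R) g :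
  lmul g (\sum_(i <- s) F i) = \sum_(i <- s) lmul g (F i).
Proof. by rewrite lmulC lmul_suml; apply/eq_bigr=> i _; rewrite lmulC. Qed.

Lemma lmulA : associative lmul.
Proof.
move=> f g h; rewrite (laurentE f) !lmul_suml; apply/eq_bigr=> i _.
rewrite (laurentE g) lmul_suml !lmul_sumr lmul_suml; apply/eq_bigr=> j _.
rewrite (laurentE h) !lmul_sumr; apply/eq_bigr=> k _.
by rewrite !lmulUU mulrA addrA.
Qed.

Lemma lmul1l : left_id lone lmul.
Proof.
move=> f; rewrite {2}(laurentE f) [in LHS](laurentE f) lmul_sumr.
by apply/eq_bigr=> k _; rewrite lmulUU mul1r add0r.
Qed.

Lemma lone_neq0 : lone != 0.
Proof. by rewrite monalgU_eq0 oner_eq0. Qed.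

End LaurentRing.

HB.instance Definition _ (R : comNzRingType) :=
  GRing.Zmodule_isComNzRing.Build (laurent R)
    (@lmulA R) (@lmulC R) (@lmul1l R) (@lmulDl R) (@lone_neq0 R).

Lemma lmonomM (R : comNzRingType) (a b : R) (i j : int) :
  lmonom a i * lmonom b j = lmonom (a * b) (i + j).
Proof. exact: lmulUU. Qed.

Lemma lcoef_monom (R : comNzRingType) (a : R) (i j : int) :
  lcoef (lmonom a i) j = if i == j then a else 0.
Proof. by rewrite /lcoef /lmonom mcoeffU; case: eqP. Qed.

(** The largest exponent with nonzero coefficient; [0] if [f = 0]. *)
Definition ldeg (R : comNzRingType) (f : laurent R) : int :=
  let s : seq int := enum_fset (msupp f) in
  \big[Num.max/head 0 s]_(k <- s) k.

Lemma ldegP (R : comNzRingType) (f : laurent R) : f != 0 ->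
  lcoef f (ldeg f) != 0 /\ forall k, ldeg f < k -> lcoef f k = 0.
Proof.
move=> f0; rewrite /ldeg /lcoef; set s : seq int := enum_fset _.
have sE k : (mcoeff k f != 0) = (k \in s) by rewrite mcoeff_neq0.
have s0 : s != [::].
  apply: contra_neq f0 => es; apply/malgP => k; rewrite mcoeff0.
  by apply/eqP; rewrite -[_ == _]negbK sE es.
split.
  rewrite sE big_seq; elim/big_ind: _ => [|x y xs ys|//].
    by case: (s) s0 => // a l _; rewrite inE eqxx.
  by rewrite maxEle; case: ifP.
move=> k ltk; apply/eqP; rewrite -[_ == _]negbK sE; apply/negP => ks.
by move: ltk; rewrite ltNge => /negP; apply; exact: (@le_bigmax_seq _ _ _ _ _ k xpredT id).
Qed.

(** Z[y^+-1, z^+-1], as Laurent polynomials in [z] over Z[y^+-1]. *)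
Notation laurent_yz := (laurent (laurent int)).

Definition ypow (i : int) : laurent int := lmonom 1 i.
Definition yX (i : int) : laurent_yz := lmonom (ypow i) 0.
Definition zX (j : int) : laurent_yz := lmonom 1 j.

Definition deg_z (f : laurent_yz) : int := ldeg f.
Definition coef_z (f : laurent_yz) (j : int) : laurent int := lcoef f j.

(** * Oriented link diagrams in the plane

    A diagram in general position with respect to the height function is cut
    by horizontal lines into slices, each containing exactly one local
    minimum, local maximum or crossing, the other strands being vertical.  It
    is recorded as the list of its slices from bottom to top; in a slice
    [(k, e)] exactly [k] vertical strands lie to the left of [e].

    A horizontal line meets the diagram in finitely many points; its [level]
    lists, from left to right, whether the strand there is oriented upwards
    ([true]) or downwards ([false]). *)

Definition level := seq bool.

Inductive elem :=
  | Cup of bool    (* local minimum; the flag orients its left leg *)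
  | Cap            (* local maximum *)
  | Cross of bool. (* [Cross true]: the strand from bottom left to top right is
                      over; [Cross false]: the strand from bottom right to top
                      left is over *)

Definition slice : Type := nat * elem.

Definition slice_run (s : level) (x : slice) : option level :=
  let: (k, e) := x in
  if (size s < k)%N then None else
  match e, drop k s with
  | Cup b, t => Some (take k s ++ b :: ~~ b :: t)
  | Cap, a :: b :: t => if a != b then Some (take k s ++ t) else None
  | Cross _, a :: b :: t => Some (take k s ++ b :: a :: t)
  | _, _ => None
  end.

(** The level above a list of slices placed on top of the level [s]; [None] if
    they do not fit together. *)
Definition run (s : level) (w : seq slice) : option level :=
  foldl (fun os x => obind (slice_run^~ x) os) (Some s) w.

Record diagram := Diagram {
  slices :> seq slice;
  slices_closed : run [::] slices = Some [::]
}.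

(** ** Isotopy

    Isotopies of the plane and Reidemeister moves, for diagrams in general
    position with respect to the height, are generated by the following local
    replacements. *)

Definition elem_in (e : elem) : nat :=
  match e with Cup _ => 0 | Cap | Cross _ => 2 end.
Definition elem_out (e : elem) : nat :=
  match e with Cap => 0 | Cup _ | Cross _ => 2 end.

Inductive move : seq slice -> seq slice -> Prop :=
  (* isotopies of the plane *)
  | move_exchange k e d e' :
      move [:: (k, e); (k + elem_out e + d, e')%N]
           [:: (k + elem_in e + d, e')%N; (k, e)]
  | move_zigzag_l k b : move [:: (k.+1, Cup b); (k, Cap)] [::]
  | move_zigzag_r k b : move [:: (k, Cup b); (k.+1, Cap)] [::]
  | move_slide_cup k b o :
      move [:: (k, Cup b); (k.+1, Cross o)]
           [:: (k.+1, Cup b); (k, Cross (~~ o))]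
  | move_slide_cap k o :
      move [:: (k.+1, Cross o); (k, Cap)]
           [:: (k, Cross (~~ o)); (k.+1, Cap)]
  (* first Reidemeister move *)
  | move_R1_cup k b o :
      move [:: (k, Cup b); (k, Cross o)] [:: (k, Cup (~~ b))]
  | move_R1_cap k o :
      move [:: (k, Cross o); (k, Cap)] [:: (k, Cap)]
  (* second Reidemeister move *)
  | move_R2 k o :
      move [:: (k, Cross o); (k, Cross (~~ o))] [::]
  (* third Reidemeister move, on strands A, B, C numbered from left to right at
     the bottom: [oAB] tells whether A is over B, and so on; the hypothesis
     excludes that each strand is over the next one in a cyclic order *)
  | move_R3 k oAB oAC oBC :
      (oAB = oBC -> oAC = oAB) ->
      move [:: (k, Cross oAB); (k.+1, Cross oAC); (k, Cross oBC)]
           [:: (k.+1, Cross oBC); (k, Cross oAC); (k.+1, Cross oAB)].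

Inductive isotopic : diagram -> diagram -> Prop :=
  | isotopic_move (D D' : diagram) pre w w' post :
      move w w' ->
      slices D = pre ++ w ++ post -> slices D' = pre ++ w' ++ post ->
      isotopic D D'
  | isotopic_refl D : isotopic D D
  | isotopic_sym D D' : isotopic D D' -> isotopic D' D
  | isotopic_trans D D' D'' :
      isotopic D D' -> isotopic D' D'' -> isotopic D D''.

(** ** Crossing signs and skein triples *)

(** Tangent vectors, in the standardly oriented plane, of the strands of a
    crossing through its bottom left, resp. bottom right, end. *)
Definition tangent_l (up : bool) : int * int := if up then (1, 1) else (-1, -1).
Definition tangent_r (up : bool) : int * int := if up then (-1, 1) else (1, -1).

Definition det2 (u v : int * int) : int := u.1 * v.2 - u.2 * v.1.

(** Sign of [Cross o] placed on the level [[:: a; b]]. *)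
Definition positive (o a b : bool) : bool :=
  0 < if o then det2 (tangent_l a) (tangent_r b)
      else det2 (tangent_r b) (tangent_l a).

(** The orientation-consistent smoothing: two vertical strands if both strands
    of the crossing have the same vertical direction, and otherwise a maximum
    below a minimum. *)
Definition smoothing (k : nat) (a b : bool) : seq slice :=
  if a == b then [::] else [:: (k, Cap); (k, Cup b)].

Inductive skein_triple (Dp Dm D0 : diagram) : Prop :=
  | SkeinTriple pre post (s t : level) (a b o : bool) :
      run [::] pre = Some (s ++ a :: b :: t) ->
      positive o a b ->
      slices Dp = pre ++ (size s, Cross o) :: post ->
      slices Dm = pre ++ (size s, Cross (~~ o)) :: post ->
      slices D0 = pre ++ smoothing (size s) a b ++ post ->
      skein_triple Dp Dm D0.

Definition unknot : diagram :=
  @Diagram [:: (0%N, Cup true); (0%N, Cap)] erefl.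

(** The properties characterising the HOMFLY polynomial; it is determined by
    them on all nonempty diagrams. *)
Record is_homfly (P : diagram -> laurent_yz) : Prop := IsHomfly {
  homfly_isotopic D D' : isotopic D D' -> P D = P D';
  homfly_unknot : P unknot = 1;
  homfly_skein Dp Dm D0 : skein_triple Dp Dm D0 ->
    yX 1 * P Dp + yX (-1) * P Dm = zX 1 * P D0
}.

(** * Braids on three strands and their closures

    Braid words: the letter [(i, true)] is the Artin generator sigma_(i+1), and
    [(i, false)] its inverse.  Strands are oriented upwards, so that
    [Cross true] is a positive crossing. *)

Definition braid3 := seq ('I_2 * bool).

Definition sigma1 : braid3 := [:: (ord0, true)].
Definition sigma2 : braid3 := [:: (ord_max, true)].

Definition braid_inv (x : braid3) : braid3 := rev [seq (l.1, ~~ l.2) | l <- x].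

Definition braid_exp (x : braid3) (n : int) : braid3 :=
  match n with
  | Posz m => flatten (nseq m x)
  | Negz m => flatten (nseq m.+1 (braid_inv x))
  end.

Definition braid_slices (x : braid3) : seq slice :=
  [seq (nat_of_ord l.1, Cross l.2) | l <- x].

(** The ends of the braid are joined by three nested arcs on its right. *)
Definition closure_slices (x : braid3) : seq slice :=
  [:: (0%N, Cup true); (1%N, Cup true); (2%N, Cup true)] ++
  braid_slices x ++
  [:: (2%N, Cap); (1%N, Cap); (0%N, Cap)].

Lemma run_cat (s : level) (w w' : seq slice) :
  run s (w ++ w') = obind (run^~ w') (run s w).
Proof.
rewrite /run foldl_cat; case: (foldl _ _ w) => [t|] //=.
by elim: w'.
Qed.

Lemma run_braid (x : braid3) (t : level) :
  run [:: true, true, true & t] (braid_slices x)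
  = Some [:: true, true, true & t].
Proof. by elim: x => // -[[[|[|//]] ?] o] x IHx; apply: IHx. Qed.

Lemma closure_closed (x : braid3) : run [::] (closure_slices x) = Some [::].
Proof.
have -> : run [::] (closure_slices x) =
    obind (run^~ [:: (2%N, Cap); (1%N, Cap); (0%N, Cap)])
      (run [:: true; true; true; false; false; false] (braid_slices x)).
  by rewrite /closure_slices run_cat; exact: run_cat.
by rewrite run_braid.
Qed.

Definition braid_closure (x : braid3) : diagram := Diagram (closure_closed x).

(** The torus link T(3, n). *)
Definition T3 (n : int) : diagram :=
  braid_closure (braid_exp (sigma1 ++ sigma2) n).

(* Main.v *)
Require Import Defs.
From mathcomp Require Import all_boot all_order all_algebra.
From mathcomp Require Import zify.
From mathcomp Require Import finmap monalg.

(** The skein relation, read on the closure of a positive 3-braid word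
    containing a square, says
      [P(u s s v) = y^-1 z P(u s v) - y^-2 P(u v)],
    because changing the sign of one letter of [s s] cancels it against the
    other.  The two words on the right have one and two letters less, so an
    induction on the number [c] of letters shows that [P] of a positive closure
    has [z]-degree at most [c - 2], and that the second term never contributes
    to the coefficient of [z^(c-2)].  That coefficient is thus multiplied by
    [y^-1] whenever a square loses a letter.  A word in which both generators
    occur keeps both of them under [s s -> s], so it ends up at [s1 s2], whose
    closure is the unknot and has [P = 1]: the coefficient of [z^(c-2)] is
    [y^(2-c)] ([positive_closure_top]).  For [(s1 s2)^n] the number of letters
    is [2 n].

    Squares always become available: up to rotation and one use of the braid
    relation, a word of at least three letters starts with a square
    ([positive_square]).  Apart from the squares of the generators, the shorter
    words are the empty one and single letters, whose degree is [c - 2] by the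
    skein relation and destabilisation, and [s1 s2] up to rotation.

    The topology behind this consists of four isotopies of closed braids:
    cancellation and the braid relation, which are Reidemeister moves inside the
    braid; rotation, i.e. carrying a crossing once around the closing arcs
    ([isotopic_rot]); and the double destabilisation of [s1^(+-1) s2^(+-1)] to
    the unknot ([isotopic_destabilise]). *)

Set Implicit Arguments.
Unset Strict Implicit.
Unset Printing Implicit Defensive.

Import Order.TTheory GRing.Theory Num.Theory.
Local Open Scope ring_scope.

(** * Coefficients of Laurent polynomials *)

Lemma lcoef_monomM (R : comNzRingType) (a : R) (i j : int) (f : laurent R) :
  lcoef (lmonom a i * f) j = a * lcoef f (j - i).
Proof.
have E : lcoef (lmonom a i * f) j =
    \sum_(k <- msupp f) lcoef (lmonom (a * lcoef f k) (i + k)) j.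
  rewrite {1}(laurentE f) mulr_sumr /lcoef raddf_sum /=.
  by apply: eq_bigr => k _; rewrite lmonomM.
rewrite E {E}.
have [kf|kf] := boolP ((j - i) \in msupp f).
  rewrite (big_fsetD1 _ kf) /= lcoef_monom subrKC eqxx big1_fset ?addr0 //.
  move=> k; rewrite !inE => /andP[/eqP nk _] _; rewrite lcoef_monom; case: eqP => // e.
  by case: nk; lia.
rewrite [X in a * X]mcoeff_outdom // mulr0 big1_fset // => k kf' _.
rewrite lcoef_monom; case: eqP => // e; move: kf; rewrite -e.
by rewrite addrC addKr kf'.
Qed.

Lemma ypowD i j : ypow i * ypow j = ypow (i + j).
Proof. by rewrite /ypow lmonomM mulr1. Qed.

Lemma yXD i j : yX i * yX j = yX (i + j).
Proof. by rewrite /yX lmonomM ypowD addr0. Qed.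

Definition deg_z_le (f : laurent_yz) (m : int) :=
  forall j : int, m < j -> coef_z f j = 0.

Lemma coef_zM a i f j : coef_z (lmonom a i * f) j = a * coef_z f (j - i).
Proof. exact: lcoef_monomM. Qed.

Lemma deg_z_le_yX i : deg_z_le (yX i) 0.
Proof. by move=> j j0; rewrite /coef_z lcoef_monom; case: eqP j0 => // <-. Qed.

Lemma deg_z_leD f g m : deg_z_le f m -> deg_z_le g m -> deg_z_le (f + g) m.
Proof.
move=> hf hg j mj; rewrite /coef_z /lcoef mcoeffD.
by rewrite [X in X + _]hf // [X in _ + X]hg // addr0.
Qed.

Lemma deg_z_leM a i f m : deg_z_le f m -> deg_z_le (lmonom a i * f) (i + m).
Proof. by move=> hf j mj; rewrite coef_zM hf ?mulr0 //; lia. Qed.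

(** For unlinks: the skein relation yields their polynomials multiplied by
    [z], since they occur in it as smoothings. *)
Lemma deg_z_le_zX f m : deg_z_le (zX 1 * f) m -> deg_z_le f (m - 1).
Proof.
move=> h j mj; have := h (j + 1); rewrite coef_zM mul1r addrK; apply; lia.
Qed.

(** * Isotopies of a part of a diagram *)

(** Replacing the slices [w], placed on the level [s], by [w'] is an isotopy in
    every diagram.  Equality of the two runs makes the relation transitive:
    together with a diagram through [w] it provides one through [w'], although a
    move as such may turn a diagram into slices that do not fit together. *)
Definition isotopic_on (s : level) (w w' : seq slice) : Prop :=
  run s w = run s w' /\
  forall pre post (D D' : diagram), run [::] pre = Some s ->
    slices D = pre ++ w ++ post -> slices D' = pre ++ w' ++ post ->
    isotopic D D'.

Lemma slices_inj (D D' : diagram) : slices D = slices D' -> D = D'.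
Proof.
by case: D D' => [w cw] [w' cw'] /= e; subst w'; congr Diagram; apply: eq_irrelevance.
Qed.

Lemma isotopic_on_refl s w : isotopic_on s w w.
Proof.
split=> // pre post D D' _ eD eD'.
by rewrite (@slices_inj D D') ?eD //; apply: isotopic_refl.
Qed.

Lemma isotopic_on_sym s w w' : isotopic_on s w w' -> isotopic_on s w' w.
Proof.
case=> e i; split=> // pre post D D' epre eD eD'.
by apply: isotopic_sym; apply: (i pre post).
Qed.

Lemma isotopic_on_trans s w w' w'' :
  isotopic_on s w w' -> isotopic_on s w' w'' -> isotopic_on s w w''.
Proof.
move=> [e i] [e' i']; split=> [|pre post D D'' epre eD eD'']; first by rewrite e.
have cD' : run [::] (pre ++ w' ++ post) = Some [::].
  by rewrite -(slices_closed D) eD !run_cat epre /= !run_cat e.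
by apply: (@isotopic_trans _ (Diagram cD')); [apply: (i pre post) | apply: (i' pre post)].
Qed.

Lemma isotopic_on_move s w w' : move w w' -> run s w = run s w' -> isotopic_on s w w'.
Proof. by move=> m e; split=> // pre post D D' _ eD eD'; apply: isotopic_move m eD eD'. Qed.

Lemma isotopic_on_in s t pre w w' post : run s pre = Some t -> isotopic_on t w w' ->
  isotopic_on s (pre ++ w ++ post) (pre ++ w' ++ post).
Proof.
move=> epre [e i]; split; first by rewrite !run_cat epre /= !run_cat e.
move=> p q D D' ep eD eD'; apply: (i (p ++ pre) (post ++ q)).
- by rewrite run_cat ep.
- by rewrite eD -!catA.
- by rewrite eD' -!catA.
Qed.

(** Chains of moves are written by applying this to the left-hand side, one
    replacement of [w] by [w'] after the other, in either direction of a move. *)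
Lemma isotopic_on_step s pre t w w' post v :
  run s pre = Some t -> move w w' \/ move w' w -> run t w = run t w' ->
  isotopic_on s (pre ++ w' ++ post) v -> isotopic_on s (pre ++ w ++ post) v.
Proof.
move=> epre m e h; apply: isotopic_on_trans h; apply: isotopic_on_in epre _.
by case: m => m; [|apply: isotopic_on_sym]; apply: isotopic_on_move.
Qed.

Arguments isotopic_on_step {s} pre {t} w w' {post v}.

(** Both directions of sliding a crossing past an extremum leave an arbitrary
    flag on one side and a negated one on the other; these two put the negation
    where the listed moves do not. *)
Lemma slide_cap_right k o :
  move [:: (k.+1, Cross (~~ o)); (k, Cap)] [:: (k, Cross o); (k.+1, Cap)].
Proof. by rewrite -{2}(negbK o); apply: move_slide_cap. Qed.

Lemma slide_cup_right k b o :
  move [:: (k, Cup b); (k.+1, Cross (~~ o))] [:: (k.+1, Cup b); (k, Cross o)].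
Proof. by rewrite -{2}(negbK o); apply: move_slide_cup. Qed.

(** * Isotopies of closed braids *)

Definition cups : seq slice :=
  [:: (0%N, Cup true); (1%N, Cup true); (2%N, Cup true)].
Definition caps : seq slice := [:: (2%N, Cap); (1%N, Cap); (0%N, Cap)].
Definition braid_level : level := [:: true; true; true; false; false; false].

Lemma run_cups_braid x : run [::] (cups ++ braid_slices x) = Some braid_level.
Proof. by rewrite run_cat /= run_braid. Qed.

Lemma isotopic_closure x y :
  isotopic_on [::] (closure_slices x) (closure_slices y) ->
  isotopic (braid_closure x) (braid_closure y).
Proof. by case=> _ /(_ [::] [::]); apply; rewrite //= cats0. Qed.

(** A crossing between strands [i] and [i + 1] of the braid slides over the two
    arcs that continue these strands and comes out between their other ends, at
    the mirror position [4 - i] among the six points of the level.  It has to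
    pass one extremum with each of its strands, which flips its flag twice. *)
Lemma caps_turn (i : 'I_2) o :
  isotopic_on braid_level ((nat_of_ord i, Cross o) :: caps) ((4 - i, Cross o)%N :: caps).
Proof.
case: i => [[|[|//]] /= _].
- apply: (isotopic_on_step [::] [:: (0, Cross o); (2, Cap)]%N
            [:: (2, Cap); (0, Cross o)]%N) => //.
    by left; exact: (move_exchange 0 (Cross o) 0 Cap).
  apply: (isotopic_on_step [:: (2, Cap)]%N [:: (0, Cross o); (1, Cap)]%N
            [:: (1, Cross (~~ o)); (0, Cap)]%N) => //.
    by right; exact: slide_cap_right.
  apply: (isotopic_on_step [:: (2, Cap); (1, Cross (~~ o))]%N [:: (0, Cap); (0, Cap)]%N
            [:: (2, Cap); (0, Cap)]%N) => //.
    by left; exact: (move_exchange 0 Cap 0 Cap).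
  apply: (isotopic_on_step [:: (2, Cap)]%N [:: (1, Cross (~~ o)); (2, Cap)]%N
            [:: (2, Cross o); (1, Cap)]%N) => //.
    by right; exact: move_slide_cap.
  apply: (isotopic_on_step [::] [:: (2, Cap); (2, Cross o)]%N
            [:: (4, Cross o); (2, Cap)]%N) => //.
    by left; exact: (move_exchange 2 Cap 0 (Cross o)).
  exact: isotopic_on_refl.
apply: (isotopic_on_step [::] [:: (1, Cross o); (2, Cap)]%N
            [:: (2, Cross (~~ o)); (1, Cap)]%N) => //.
  by right; exact: slide_cap_right.
apply: (isotopic_on_step [:: (2, Cross (~~ o))]%N [:: (1, Cap); (1, Cap)]%N
            [:: (3, Cap); (1, Cap)]%N) => //.
  by left; exact: (move_exchange 1 Cap 0 Cap).
apply: (isotopic_on_step [::] [:: (2, Cross (~~ o)); (3, Cap)]%N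
            [:: (3, Cross o); (2, Cap)]%N) => //.
  by right; exact: move_slide_cap.
exact: isotopic_on_refl.
Qed.

Lemma cups_turn (i : 'I_2) o :
  isotopic_on [::] (cups ++ [:: (nat_of_ord i, Cross o)]) (cups ++ [:: (4 - i, Cross o)%N]).
Proof.
case: i => [[|[|//]] /= _].
- apply: (isotopic_on_step [:: (0, Cup true); (1, Cup true)]%N
    [:: (2, Cup true); (0, Cross o)]%N [:: (0, Cross o); (2, Cup true)]%N) => //.
    by right; exact: (move_exchange 0 (Cross o) 0 (Cup true)).
  apply: (isotopic_on_step [:: (0, Cup true)]%N [:: (1, Cup true); (0, Cross o)]%N
            [:: (0, Cup true); (1, Cross (~~ o))]%N) => //.
    by right; exact: slide_cup_right.
  apply: (isotopic_on_step [::] [:: (0, Cup true); (0, Cup true)]%N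
            [:: (0, Cup true); (2, Cup true)]%N) => //.
    by right; exact: (move_exchange 0 (Cup true) 0 (Cup true)).
  apply: (isotopic_on_step [:: (0, Cup true)]%N [:: (2, Cup true); (1, Cross (~~ o))]%N
            [:: (1, Cup true); (2, Cross o)]%N) => //.
    by right; exact: move_slide_cup.
  apply: (isotopic_on_step [:: (0, Cup true); (1, Cup true)]%N
    [:: (2, Cross o); (2, Cup true)]%N [:: (2, Cup true); (4, Cross o)]%N) => //.
    by right; exact: (move_exchange 2 (Cup true) 0 (Cross o)).
  exact: isotopic_on_refl.
apply: (isotopic_on_step [:: (0, Cup true); (1, Cup true)]%N [:: (2, Cup true); (1, Cross o)]%N
            [:: (1, Cup true); (2, Cross (~~ o))]%N) => //.
  by right; exact: slide_cup_right.
apply: (isotopic_on_step [:: (0, Cup true)]%N [:: (1, Cup true); (1, Cup true)]%N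
            [:: (1, Cup true); (3, Cup true)]%N) => //.
  by right; exact: (move_exchange 1 (Cup true) 0 (Cup true)).
apply: (isotopic_on_step [:: (0, Cup true); (1, Cup true)]%N [:: (3, Cup true); (2, Cross (~~ o))]%N
            [:: (2, Cup true); (3, Cross o)]%N) => //.
  by right; exact: move_slide_cup.
exact: isotopic_on_refl.
Qed.

Lemma braid_turn (i : 'I_2) o x :
  isotopic_on braid_level ((4 - i, Cross o)%N :: braid_slices x)
           (rcons (braid_slices x) (4 - i, Cross o)%N).
Proof.
elim: x => [|[j o'] x IHx] /=; first exact: isotopic_on_refl.
apply: (isotopic_on_step [::] [:: (4 - i, Cross o)%N; (nat_of_ord j, Cross o')]
                       [:: (nat_of_ord j, Cross o'); (4 - i, Cross o)%N]).
- by [].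
- right; have -> : (4 - i = j + 2 + (2 - i - j))%N.
    by case: (i) (j) => [[|[|//]] ?] [[|[|//]] ?].
  exact: move_exchange.
- by case: (i) (j) => [[|[|//]] ?] [[|[|//]] ?].
have e : run braid_level [:: (nat_of_ord j, Cross o')] = Some braid_level
  by case: (j) => [[|[|//]] ?].
by have := isotopic_on_in [::] e IHx; rewrite !cats0.
Qed.

(** The crossing is carried around the closure: through the lower arcs to the
    right of the braid, up along the braid, and back through the upper arcs. *)
Lemma isotopic_rot (l : 'I_2 * bool) x :
  isotopic (braid_closure (l :: x)) (braid_closure (rcons x l)).
Proof.
case: l => i o; apply: isotopic_closure.
have [c b h] := And3 (cups_turn i o) (braid_turn i o x) (caps_turn i o).
rewrite /closure_slices /braid_slices map_rcons -/(braid_slices x) -cats1 -catA.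
apply: (isotopic_on_trans (w' := cups ++ (4 - i, Cross o)%N :: braid_slices x ++ caps)).
  have := isotopic_on_in (s := [::]) (pre := [::]) (braid_slices x ++ caps) erefl c.
  by rewrite -!catA.
apply: (isotopic_on_trans (w' := cups ++ braid_slices x ++ (4 - i, Cross o)%N :: caps)).
  have := isotopic_on_in (s := [::]) (pre := cups) (caps) erefl b.
  by rewrite cat_rcons.
have := isotopic_on_in [::] (run_cups_braid x) (isotopic_on_sym h).
by rewrite !cats0 -!catA.
Qed.

Lemma isotopic_subword u v x y :
  isotopic_on braid_level (braid_slices x) (braid_slices y) ->
  isotopic (braid_closure (u ++ x ++ v)) (braid_closure (u ++ y ++ v)).
Proof.
move=> h; apply: isotopic_closure.
have := isotopic_on_in (braid_slices v ++ caps) (run_cups_braid u) h.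
by rewrite /closure_slices /braid_slices !map_cat -!catA.
Qed.

Lemma isotopic_cancel i u v :
  isotopic (braid_closure (u ++ [:: (i, true); (i, false)] ++ v))
    (braid_closure (u ++ v)).
Proof.
apply: (@isotopic_subword u v _ [::]); apply: isotopic_on_move.
  exact: (move_R2 i true).
by case: i => [[|[|//]] ?].
Qed.

(** Two destabilisations.  Each moves the crossing on the innermost arc next to
    its minimum, where the first Reidemeister move removes it and a zigzag is
    left to be straightened. *)
Lemma isotopic_destabilise o1 o2 :
  isotopic (braid_closure [:: (ord0, o1); (ord_max, o2)]) unknot.
Proof.
suff h : isotopic_on [::] (closure_slices [:: (ord0, o1); (ord_max, o2)]) unknot.
  by case: h => _ /(_ [::] [::]); apply; rewrite //= cats0.
rewrite /closure_slices /=.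
apply: (isotopic_on_step [:: (0, Cup true); (1, Cup true)]%N
  [:: (2, Cup true); (0, Cross o1)]%N [:: (0, Cross o1); (2, Cup true)]%N) => //.
  by right; exact: (move_exchange 0 (Cross o1) 0 (Cup true)).
apply: (isotopic_on_step [:: (0, Cup true); (1, Cup true); (0, Cross o1); (2, Cup true)]%N
  [:: (1, Cross o2); (2, Cap)]%N [:: (2, Cross (~~ o2)); (1, Cap)]%N) => //.
  by right; exact: slide_cap_right.
apply: (isotopic_on_step [:: (0, Cup true); (1, Cup true); (0, Cross o1)]%N
  [:: (2, Cup true); (2, Cross (~~ o2))]%N [:: (2, Cup false)]%N) => //.
  by left; exact: move_R1_cup.
apply: (isotopic_on_step [:: (0, Cup true); (1, Cup true); (0, Cross o1)]%N
  [:: (2, Cup false); (1, Cap)]%N [::]) => //.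
  by left; exact: move_zigzag_l.
apply: (isotopic_on_step [:: (0, Cup true); (1, Cup true)]%N
  [:: (0, Cross o1); (1, Cap)]%N [:: (1, Cross (~~ o1)); (0, Cap)]%N) => //.
  by right; exact: slide_cap_right.
apply: (isotopic_on_step [:: (0, Cup true)]%N
  [:: (1, Cup true); (1, Cross (~~ o1))]%N [:: (1, Cup false)]%N) => //.
  by left; exact: move_R1_cup.
apply: (isotopic_on_step [:: (0, Cup true)]%N [:: (1, Cup false); (0, Cap)]%N [::]) => //.
  by left; exact: move_zigzag_l.
exact: isotopic_on_refl.
Qed.

Lemma skein_braid u v (i : 'I_2) :
  skein_triple (braid_closure (u ++ (i, true) :: v))
    (braid_closure (u ++ (i, false) :: v)) (braid_closure (u ++ v)).
Proof.
apply: (@SkeinTriple _ _ _ (cups ++ braid_slices u) (braid_slices v ++ caps)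
  (nseq i true) (nseq (1 - i) true ++ nseq 3 false) true true true) => //.
- by rewrite run_cups_braid; case: (i) => [[|[|//]] ?].
all: by rewrite /= /closure_slices /braid_slices ?map_cat ?size_nseq -!catA.
Qed.

(** * Positive words *)

(** The generators are named by booleans, so that [~~ c] is the other one. *)
Definition sigma (c : bool) : 'I_2 := if c then ord_max else ord0.
Definition positive_word (w : seq bool) : braid3 := [seq (sigma c, true) | c <- w].
Definition positive_closure (w : seq bool) : diagram := braid_closure (positive_word w).

Lemma isotopic_positive_rot c w :
  isotopic (positive_closure (c :: w)) (positive_closure (rcons w c)).
Proof. by rewrite /positive_closure /positive_word map_rcons; exact: isotopic_rot. Qed.

Lemma isotopic_braid_relation c u v :
  isotopic (positive_closure (u ++ [:: c; ~~ c; c] ++ v))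
           (positive_closure (u ++ [:: ~~ c; c; ~~ c] ++ v)).
Proof.
rewrite /positive_closure /positive_word !map_cat; apply: isotopic_subword.
have h : isotopic_on braid_level (braid_slices (positive_word [:: false; true; false]))
                  (braid_slices (positive_word [:: true; false; true])).
  by apply: isotopic_on_move => //; apply: move_R3.
by case: c; [apply: isotopic_on_sym|].
Qed.

(** Among the first three letters either two neighbours agree, and then a
    rotation brings them to the front, or the word is [a b a v].  If [v] is empty
    or starts with [a], then [a] closes up to a square after a rotation;
    otherwise [a (b a b)] becomes [a (a b a)].  Since that last step changes the
    number of occurrences of each letter, only the length and the set of letters
    are preserved. *)
Lemma positive_square w : (2 < size w)%N ->
  exists (c : bool) (v : seq bool), [/\ size w = (size v).+2, w =i [:: c, c & v] &
    isotopic (positive_closure w) (positive_closure [:: c, c & v])].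
Proof.
have rot1 := isotopic_positive_rot.
have rot2 a b v : isotopic (positive_closure [:: a, b & v])
                           (positive_closure (v ++ [:: a; b])).
  apply: isotopic_trans (rot1 _ _) _; rewrite rcons_cons.
  by apply: isotopic_trans (rot1 _ _) _; rewrite -!cats1 -catA; apply: isotopic_refl.
case: w => [|a [|b [|d v]]] //= _.
have [<-|ab] := eqVneq a b.
  by exists a, (d :: v); split=> //; apply: isotopic_refl.
have [<-|bd] := eqVneq b d.
  exists b, (rcons v a); split; last exact: (rot1 a [:: b, b & v]).
    by rewrite size_rcons.
  by move=> x; rewrite -!rcons_cons mem_rcons.
have -> : d = a by case: a b d ab bd => [] [] [].
have {bd ab} -> : b = ~~ a by case: a b ab {bd} => [] [].
case: v => [|e v].
  exists a, [:: ~~ a]; split=> //.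
  by move=> x; rewrite !inE; case: (a) (x) => [] [].
have [->|ae] := eqVneq e a.
  exists a, (v ++ [:: a; ~~ a]); split; last exact: (rot2 a (~~ a) [:: a, a & v]).
    by rewrite size_cat addnC.
  by move=> x; rewrite !(inE, mem_cat); case: a x (x \in v) => [] [] [].
have -> : e = ~~ a by case: a e ae => [] [].
exists a, [:: ~~ a, a & v]; split=> //.
  by move=> x; rewrite !inE; case: (a) (x) => [] [].
exact: isotopic_sym (isotopic_braid_relation a [:: a] v).
Qed.

(** * The HOMFLY polynomial of positive closed 3-braids *)

Lemma skein_solve (R : comNzRingType) (y y' z a b c : R) :
  y' * y = 1 -> y * a + y' * b = z * c -> a = y' * z * c - y' * y' * b.
Proof. by move=> y1 e; rewrite -(mulrA _ z) -e mulrDr !mulrA y1 mul1r addrK. Qed.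

Lemma homfly_square P (HP : is_homfly P) c v :
  P (positive_closure [:: c, c & v]) =
    lmonom (ypow (-1)) 1 * P (positive_closure (c :: v))
    - yX (-2) * P (positive_closure v).
Proof.
have y1 : yX (-1) * yX 1 = 1 by rewrite yXD addNr.
have yz : yX (-1) * zX 1 = lmonom (ypow (-1)) 1.
  by rewrite /yX /zX lmonomM mulr1 add0r.
have yy : yX (-1) * yX (-1) = yX (-2) by rewrite yXD; congr yX.
have sk := homfly_skein HP (skein_braid [:: (sigma c, true)] (positive_word v) (sigma c)).
rewrite (homfly_isotopic HP (isotopic_cancel (sigma c) [::] (positive_word v))) in sk.
by have := skein_solve y1 sk; rewrite yz yy.
Qed.

Lemma homfly_square_coef P (HP : is_homfly P) c v j :
  coef_z (P (positive_closure [:: c, c & v])) j =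
    ypow (-1) * coef_z (P (positive_closure (c :: v))) (j - 1)
    - ypow (-2) * coef_z (P (positive_closure v)) j.
Proof.
rewrite homfly_square // -[in RHS](subr0 j) -!coef_zM subr0.
by rewrite /coef_z /lcoef mcoeffB.
Qed.

Lemma homfly_destabilise P (HP : is_homfly P) o1 o2 :
  P (braid_closure [:: (ord0, o1); (ord_max, o2)]) = 1.
Proof. by rewrite (homfly_isotopic HP (isotopic_destabilise o1 o2)) (homfly_unknot HP). Qed.

Lemma homfly_sigma1 P (HP : is_homfly P) o :
  zX 1 * P (braid_closure [:: (ord0, o)]) = yX 1 + yX (-1).
Proof.
by rewrite -(homfly_skein HP (skein_braid [:: (ord0, o)] [::] ord_max)) /=
  !homfly_destabilise // !mulr1.
Qed.

Lemma homfly_sigma2 P (HP : is_homfly P) :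
  zX 1 * P (braid_closure [:: (ord_max, true)]) = yX 1 + yX (-1).
Proof.
by rewrite -(homfly_skein HP (skein_braid [::] [:: (ord_max, true)] ord0)) /=
  !homfly_destabilise // !mulr1.
Qed.

Lemma skein_smoothing (R : comNzRingType) (y y' z a b c t : R) :
  z * a = t -> z * b = t -> y * a + y' * b = z * c -> z * (z * c) = (y + y') * t.
Proof. by move=> at_ bt <-; rewrite mulrDr mulrDl !(mulrCA z) at_ bt. Qed.

Lemma homfly_trivial P (HP : is_homfly P) :
  zX 1 * (zX 1 * P (braid_closure [::])) = (yX 1 + yX (-1)) * (yX 1 + yX (-1)).
Proof.
exact: skein_smoothing (homfly_sigma1 HP true) (homfly_sigma1 HP false)
  (homfly_skein HP (skein_braid [::] [::] ord0)).
Qed.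

Lemma homfly_positive_unknot P (HP : is_homfly P) c :
  P (positive_closure [:: c; ~~ c]) = 1.
Proof.
case: c; last exact: (homfly_destabilise HP true true).
rewrite (homfly_isotopic HP (isotopic_positive_rot true [:: false])).
exact: (homfly_destabilise HP true true).
Qed.

Lemma positive_closure_short P (HP : is_homfly P) w :
  w \in [:: [::]; [:: false]; [:: true]; [:: false; true]; [:: true; false]] ->
  deg_z_le (P (positive_closure w)) ((size w)%:Z - 2).
Proof.
have hy : deg_z_le (yX 1 + yX (-1)) 0 by apply: deg_z_leD; apply: deg_z_le_yX.
have h1 c : deg_z_le (P (positive_closure [:: c])) (- 1).
  by apply: (@deg_z_le_zX _ 0); case: c; rewrite ?homfly_sigma2 ?homfly_sigma1.
have h2 c : deg_z_le (P (positive_closure [:: c; ~~ c])) 0.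
  by rewrite homfly_positive_unknot //; exact: (deg_z_le_yX 0).
rewrite !inE; case/or4P => [/eqP->|/eqP->|/eqP->|/orP[/eqP->|/eqP->]].
- apply: (@deg_z_le_zX _ (-1)); apply: (@deg_z_le_zX _ 0).
  rewrite homfly_trivial // mulrDl.
  by apply: deg_z_leD; apply: (@deg_z_leM _ 0 _ 0).
- exact: h1.
- exact: h1.
- exact: (h2 false).
- exact: (h2 true).
Qed.

(** The degree bound holds for every word, as it must for the second statement:
    the word left after removing a whole square may lack a generator. *)
Lemma positive_closure_top P (HP : is_homfly P) (w : seq bool) :
  deg_z_le (P (positive_closure w)) ((size w)%:Z - 2) /\
  (true \in w -> false \in w ->
   coef_z (P (positive_closure w)) ((size w)%:Z - 2) = ypow (2 - (size w)%:Z)).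
Proof.
have [n] := ubnP (size w); elim: n w => // n IHn w; rewrite ltnS => le_n.
have [[c [v [sw mw iw]]]|w2] :
    (exists (c : bool) (v : seq bool), [/\ size w = (size v).+2, w =i [:: c, c & v] &
       isotopic (positive_closure w) (positive_closure [:: c, c & v])]) \/
    w \in [:: [::]; [:: false]; [:: true]; [:: false; true]; [:: true; false]].
- have [/positive_square ?|] := ltnP 2 (size w); first by left.
  case: w {le_n} => [|a [|b [|//]]] _; first by right.
    by right; case: a.
  have [<-|ab] := eqVneq a b; last by right; case: a b ab => [] [].
  by left; exists a, [::]; split=> //; apply: isotopic_refl.
- rewrite sw in le_n.
  have /= [hcv ecv] := IHn (c :: v) le_n; have [hv _] := IHn v (ltnW le_n).
  rewrite (homfly_isotopic HP iw) sw; split=> [j lj|].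
    by rewrite homfly_square_coef // hcv ?hv ?mulr0 ?subr0 //; lia.
  rewrite !mw !inE !orbA !orbb => t f.
  rewrite homfly_square_coef // hv ?mulr0 ?subr0; last by lia.
  rewrite (_ : _ - 1 = (size v).+1%:Z - 2); last by lia.
  by rewrite ecv // ypowD; congr ypow; lia.
split; first exact: positive_closure_short.
move: w2; rewrite !inE; case/or4P => [/eqP->|/eqP->|/eqP->|/orP[/eqP->|/eqP->]] //= _ _.
  by rewrite (homfly_positive_unknot HP false) /coef_z lcoef_monom.
by rewrite (homfly_positive_unknot HP true) /coef_z lcoef_monom.
Qed.

Theorem proposition35 (P : diagram -> laurent_yz) (HP : is_homfly P)
    (n : int) (hn : 1 <= n) :
  [/\ P (T3 n) != 0,
      deg_z (P (T3 n)) = 2 * n - 2,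
      coef_z (P (T3 n)) (2 * n - 2) = ypow (- 2 * n + 2)
    & forall j : int, 2 * n - 2 < j -> coef_z (P (T3 n)) j = 0].
Proof.
case: n hn => // m m1.
set w := flatten (nseq m [:: false; true]).
have sw : size w = (2 * m)%N by rewrite /w size_flatten /shape map_nseq sumn_nseq.
have mem_w c : c \in w.
  by rewrite /w; case: (m) m1 => // m' _; case: c.
have eT : T3 m = positive_closure w.
  rewrite /T3 /positive_closure /w /=; congr braid_closure.
  by elim: (m) => //= k ->.
have [le_deg] := positive_closure_top HP w; rewrite -eT sw => /(_ (mem_w _) (mem_w _)).
rewrite (_ : (2 * m)%N%:Z - 2 = 2 * Posz m - 2); last by lia.
rewrite (_ : 2 - (2 * m)%N%:Z = - 2 * Posz m + 2); last by lia.
move=> top.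
have {}le_deg j : 2 * Posz m - 2 < j -> coef_z (P (T3 m)) j = 0.
  by move=> lj; rewrite eT; apply: le_deg; rewrite sw; lia.
have topn0 : coef_z (P (T3 m)) (2 * Posz m - 2) != 0 by rewrite top monalgU_eq0.
have Pn0 : P (T3 m) != 0.
  by apply: contraNneq topn0 => ->; rewrite /coef_z /lcoef mcoeff0.
split=> //.
have [d0 dgt] := ldegP Pn0.
apply/eqP; rewrite eq_le; apply/andP; split; rewrite leNgt; apply/negP => lt.
  by move: d0; rewrite [lcoef _ _]le_deg ?eqxx.
by move: topn0; rewrite [coef_z _ _]dgt ?eqxx.
Qed.
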